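(* For every non-negative integer $N$, \[\sum_{\pi\in\mathcal{D}_{\le N}} q^{\mathcal{E}(\pi)} = \sum_{\pi\in\mathcal{RR}_{\le N-1}} \hat{\omega}(\pi)\, q^{|\pi|},\] where for $\pi=(\lambda_1,\dots,\lambda_k)$ with $k\ge1$ parts, $\hat{\omega}(\pi)=(N-\lambda_1)\,\lambda_k\prod_{i=1}^{k-1}(\lambda_i-\lambda_{i+1}-1)$, and $\hat{\omega}(\emptyset)=N+1$.
   Context: A partition $\pi=(\lambda_1,\lambda_2,\dots)$ is a finite non-increasing sequence of positive integers; the empty sequence is the unique partition of $0$; $|\pi|$ is the sum of its parts. $\mathcal{D}_{\le N}$ is the set of partitions into distinct parts all $\le N$. $\mathcal{RR}_{\le M}$ is the set of partitions into parts $\le M$ in which consecutive parts differ by at least $2$. $\mathcal{E}(\pi)=\lambda_2+\lambda_4+\lambda_6+\cdots$. *)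

(* Defs.v *)
From mathcomp Require Import all_boot all_order all_algebra.
From mathcomp Require Import boolp classical_sets cardinality fsbigop.

Set Implicit Arguments.
Unset Strict Implicit.
Unset Printing Implicit Defensive.

Import Order.TTheory GRing.Theory Num.Theory.

Local Open Scope classical_set_scope.
Local Open Scope ring_scope.

Definition is_partition (p : seq nat) : bool :=
  sorted geq p && all (fun x => 0 < x)%N p.

(* The i-th part with 1-based indexing: the largest part is [part p 1]. *)
Definition part (p : seq nat) (i : nat) : nat := nth 0%N p i.-1.

Definition weight (p : seq nat) : nat := (\sum_(1 <= i < (size p).+1) part p i)%N.

Definition even_weight (p : seq nat) : nat :=
  (\sum_(1 <= i < (size p).+1 | ~~ odd i) part p i)%N.

Definition D_le (N : nat) : set (seq nat) :=
  [set p | is_partition p /\ uniq p /\ all (fun x => x <= N)%N p].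

(* The bound is an integer so that the bound N - 1 makes sense for N = 0. *)
Definition RR_le (M : int) : set (seq nat) :=
  [set p | is_partition p /\
           (forall i, (1 <= i < size p)%N -> (part p i.+1 + 2 <= part p i)%N) /\
           all (fun x => x%:Z <= M) p].

Definition omega_hat (N : nat) (p : seq nat) : int :=
  if p is [::] then N%:Z + 1
  else (N%:Z - (part p 1)%:Z) * (part p (size p))%:Z *
       \prod_(1 <= i < size p) ((part p i)%:Z - (part p i.+1)%:Z - 1).

(* [\sum_(p \in A) f p] is 0 by convention when f has infinite support on A;
   the next two facts show that this convention is never used here. *)
Lemma finite_D_le (N : nat) : finite_set (D_le N).
Proof.
pose f (A : {set 'I_N.+1}) := [seq x <- rev (iota 1 N) | inord x \in A].
apply: (@sub_finite_set _ _ (f @` [set: {set 'I_N.+1}])); last exact/finite_image.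
move=> p [/andP[sp pos] [up leN]].
exists [set x : 'I_N.+1 | (x : nat) \in p]%SET => //.
apply: (@sorted_eq _ geq) => //.
- by move=> a b c /= ba ac; exact: leq_trans ac ba.
- by move=> a b /= /andP[ba ab]; apply/eqP; rewrite eqn_leq ab ba.
- apply: sorted_filter; first by move=> a b c /= ba ac; exact: leq_trans ac ba.
  by rewrite rev_sorted; exact: iota_sorted.
apply: uniq_perm => //; first by rewrite filter_uniq // rev_uniq iota_uniq.
move=> x; rewrite mem_filter mem_rev mem_iota add1n ltnS inE.
apply/idP/idP => [/and3P[xp x0 xN]|xp]; first by rewrite inordK in xp.
have xN := allP leN _ xp; have x0 := allP pos _ xp.
by rewrite inordK ?ltnS// xp x0.
Qed.

Lemma finite_RR_le (M : int) : finite_set (RR_le M).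
Proof.
apply: (@sub_finite_set _ _ (D_le `|M|%N)); last exact: finite_D_le.
move=> p [/[dup] pp /andP[sp pos] [gap leM]]; split => //; split.
  suff : sorted gtn p.
    by apply: sorted_uniq => [a b c /= ba ac|a /=]; [exact: ltn_trans ac ba|rewrite ltnn].
  apply/(sortedP 0%N) => i isz /=.
  by have := gap i.+1 isz; rewrite /part /= addn2; apply: leq_trans.
apply/allP => x /(allP leM) xM.
by rewrite -lez_nat abszE (le_trans xM)// ler_norm.
Qed.

(* Main.v *)
Require Import Defs.
From mathcomp Require Import all_boot all_order all_algebra.
From mathcomp Require Import boolp classical_sets cardinality fsbigop.
From mathcomp Require Import zify ring.

Import Order.TTheory GRing.Theory Num.Theory.
Local Open Scope classical_set_scope.
Local Open Scope ring_scope.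

(** Let [A N] and [B N] be the generating functions over [D_le N] of the sum of
the even-indexed and of the odd-indexed parts.  Splitting [D_le N.+1] according
to whether [N.+1] is a part, and noting that adding a new largest part exchanges
the two parities, gives [A N.+1 = A N + B N] and
[B N.+1 = B N + 'X^(N.+1) * A N], with [A 0 = B 0 = 1].

The weight [omega_hat N] vanishes on [D_le N] outside [RR_le (N - 1)], so the
right-hand side [W N] may also be summed over [D_le N].  The weight is affine in
[N], and [omega_hat N (x.+1 :: p) = (N - x.+1) * omega_hat x p]; hence [W] and
its increment [Y N = W N.+1 - W N] satisfy the same recursion as [A] and [B]. *)

Lemma D_leP (N : nat) (p : seq nat) :
  D_le N p <-> sorted gtn p && all (fun x => 0 < x <= N)%N p.
Proof.
rewrite /D_le /is_partition /= gtn_sorted_uniq_geq all_predI.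
split=> [[/andP[-> ->] [-> ->]] //|].
by move=> /andP[/andP[-> ->]] /andP[-> ->].
Qed.

Lemma D_le0 : D_le 0 = [set [::]].
Proof.
apply/seteqP; split=> [[|x p] /D_leP|p -> ]; [by []| |exact/D_leP].
by move=> /= /and3P[_]; case: x.
Qed.

Lemma D_leS (N : nat) : D_le N.+1 = D_le N `|` (cons N.+1) @` D_le N.
Proof.
apply/seteqP; split=> [p /D_leP /andP[sp ap]|p [/D_leP /andP[sp ap]|[s]]].
- case: p sp ap => [|x s] sp ap; first by left; apply/D_leP.
  (* Only the head can equal [N.+1]: strict decrease keeps the tail below [x]. *)
  have sgt : all (gtn x) s.
    by apply: order_path_min sp => a b c /= ba ac; exact: ltn_trans ac ba.
  move: ap => /= /andP[/andP[x0 xN] sN].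
  have lesN y : y \in s -> (0 < y < x)%N.
    by move=> ys; have /= := allP sgt _ ys; have /andP[-> _] := allP sN _ ys.
  move: xN; rewrite leq_eqVlt => /orP[/eqP xN|xN].
    right; exists s; last by rewrite xN.
    apply/D_leP; rewrite (path_sorted sp) /=; apply/allP => y /lesN.
    by rewrite xN.
  left; apply/D_leP; rewrite sp /= x0 -ltnS xN /=; apply/allP => y /lesN.
  by lia.
- apply/D_leP; rewrite sp; apply: sub_all ap => x; lia.
move=> /D_leP /andP[ss sa] <-; apply/D_leP.
rewrite /= leqnn path_min_sorted ?ss /=; first by apply: sub_all sa => x; lia.
by apply: sub_all sa => x /=; lia.
Qed.

Lemma sum_D_le0 (f : seq nat -> {poly int}) :
  \sum_(p \in D_le 0) f p = f [::].
Proof. by rewrite D_le0 fsbig_set1. Qed.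

Lemma sum_D_leS (f : seq nat -> {poly int}) (N : nat) :
  \sum_(p \in D_le N.+1) f p =
  \sum_(p \in D_le N) f p + \sum_(p \in D_le N) f (N.+1 :: p).
Proof.
rewrite D_leS fsbigU0 /=; first by rewrite fsbig_image // => p s _ _ [].
- exact: finite_D_le.
- exact/finite_image/finite_D_le.
- move=> p [/D_leP /andP[_ ap]] [s _ sp]; move: ap; rewrite -sp /=.
  by rewrite ltnn.
Qed.

Definition odd_weight (p : seq nat) : nat :=
  (\sum_(1 <= i < (size p).+1 | odd i) part p i)%N.

Lemma weight_cons (x : nat) (p : seq nat) : weight (x :: p) = (x + weight p)%N.
Proof. by rewrite /weight big_nat_recl //= !big_add1. Qed.

Lemma even_weight_cons (x : nat) (p : seq nat) :
  even_weight (x :: p) = odd_weight p.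
Proof.
rewrite /even_weight /odd_weight big_mkcond big_nat_recl //= add0n.
rewrite !big_add1 /= [RHS]big_mkcond /=.
by apply: eq_bigr => i _; rewrite negbK.
Qed.

Lemma odd_weight_cons (x : nat) (p : seq nat) :
  odd_weight (x :: p) = (x + even_weight p)%N.
Proof.
rewrite /even_weight /odd_weight big_mkcond big_nat_recl //=.
by rewrite !big_add1 /= [in RHS]big_mkcond.
Qed.

(** The gap factor [x.+1 - y - 1] equals [x - y], the leading factor of [omega_hat x (y :: p)]. For
    empty [p], the last part [x.+1] is the value [x + 1] prescribed for [omega_hat x [::]]. *)
Lemma omega_hat_cons (N x : nat) (p : seq nat) :
  omega_hat N (x.+1 :: p) = (N%:Z - x.+1%:Z) * omega_hat x p.
Proof.
case: p => [|y p] /=; rewrite /part /=.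
  by rewrite big_geq // mulr1; congr (_ * _); lia.
rewrite big_nat_recl //= big_add1 /=.
have -> : x.+1%:Z - y%:Z - 1 = x%:Z - y%:Z by lia.
rewrite !mulrA; congr (_ * _); last by rewrite big_add1.
by ring.
Qed.

(** The coefficient of [N] in the affine function [omega_hat N p], read off from its values at 0 and
    1. *)
Definition omega_slope (p : seq nat) : int := omega_hat 1 p - omega_hat 0 p.

Lemma omega_hatS (N : nat) (p : seq nat) :
  omega_hat N.+1 p = omega_hat N p + omega_slope p.
Proof.
rewrite /omega_slope; case: p => [|x p] /=; first by lia.
by rewrite -addn1 PoszD; ring.
Qed.

Lemma omega_slope_cons (x : nat) (p : seq nat) :
  omega_slope (x.+1 :: p) = omega_hat x p.
Proof. by rewrite /omega_slope !omega_hat_cons; ring. Qed.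

Lemma RR_le_sub_D_le (N : nat) : RR_le (N%:Z - 1) `<=` D_le N.
Proof.
move=> p [/andP[sp pos] [gap leN]]; apply/D_leP; apply/andP; split.
  apply/(sortedP 0%N) => i isz /=.
  by have := gap i.+1 isz; rewrite /part /= addn2; apply: leq_trans.
by apply/allP => x xp; have := allP pos _ xp; have := allP leN _ xp; lia.
Qed.

(** Among strictly decreasing sequences bounded by [N], leaving [RR_le (N - 1)] means that the
    largest part is [N] or that some gap is exactly 1; either kills a factor. The proof runs this
    contrapositively. *)
Lemma omega_hat_eq0 (N : nat) (p : seq nat) :
  D_le N p -> ~ RR_le (N%:Z - 1) p -> omega_hat N p = 0.
Proof.
move=> Dp; apply: contra_notP => /eqP.
have [pp [_ leN]] := Dp; have /D_leP/andP[sp _] := Dp.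
case: p pp sp leN {Dp} => [|x p] pp sp leN.
  by move=> _; split=> //; split=> // -[].
rewrite /omega_hat !mulf_eq0 !negb_or => /andP[/andP[xN _] prod_neq0].
split=> //; split=> [i ip|].
  have /(sortedP 0%N)/(_ i.-1) := sp.
  rewrite prednK; last by case/andP: ip.
  move=> /(_ (proj2 (andP ip))) /= lti.
  have /= : (part (x :: p) i)%:Z - (part (x :: p) i.+1)%:Z - 1 != 0.
    rewrite prodf_seq_neq0 in prod_neq0.
    by apply: (allP prod_neq0); rewrite mem_index_iota.
  by move: lti; rewrite /part /=; lia.
have sgt : all (gtn x) p.
  by apply: order_path_min sp => a b c /= ba ac; exact: ltn_trans ac ba.
move: leN xN; rewrite /part /= => /andP[xN _] xneN.
apply/andP; split; first by lia.
by apply: sub_all sgt => y /=; lia.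
Qed.

Lemma sum_RR_le_D_le (N : nat) :
  \sum_(p \in RR_le (N%:Z - 1)) (omega_hat N p)%:P * 'X^(weight p) =
  \sum_(p \in D_le N) (omega_hat N p)%:P * 'X^(weight p) :> {poly int}.
Proof.
apply: fsbig_widen; first exact: RR_le_sub_D_le.
by move=> p [Dp nRp] /=; rewrite omega_hat_eq0 // mul0r.
Qed.

Lemma sum_omega_hatS (N : nat) :
  \sum_(p \in D_le N.+1) (omega_hat N.+1 p)%:P * 'X^(weight p) =
  \sum_(p \in D_le N) (omega_hat N p)%:P * 'X^(weight p) +
  \sum_(p \in D_le N) (omega_slope p)%:P * 'X^(weight p) :> {poly int}.
Proof.
(* Partitions with largest part [N.+1] contribute nothing: their first factor is [N.+1 - N.+1]. *)
rewrite sum_D_leS [X in _ + X]fsbig1 ?addr0; last first.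
  by move=> p _; rewrite omega_hat_cons subrr mul0r mul0r.
rewrite -fsbig_split /=; last exact: finite_D_le.
by apply: eq_fsbigr => p _; rewrite omega_hatS polyCD mulrDl.
Qed.

Lemma sum_omega_slopeS (N : nat) :
  \sum_(p \in D_le N.+1) (omega_slope p)%:P * 'X^(weight p) =
  \sum_(p \in D_le N) (omega_slope p)%:P * 'X^(weight p) +
  'X^(N.+1) * \sum_(p \in D_le N) (omega_hat N p)%:P * 'X^(weight p)
  :> {poly int}.
Proof.
rewrite sum_D_leS mulr_fsumr; congr (_ + _); apply: eq_fsbigr => p _.
by rewrite omega_slope_cons weight_cons exprD mulrCA.
Qed.

(** The two recursions are coupled, so both identities go through a single induction. At [N = 0]
    only the empty partition remains, where [omega_hat] and [omega_slope] are both 1. *)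
Lemma sum_even_odd_weight (N : nat) :
  \sum_(p \in D_le N) ('X^(even_weight p) : {poly int}) =
    \sum_(p \in D_le N) (omega_hat N p)%:P * 'X^(weight p) :> {poly int} /\
  \sum_(p \in D_le N) ('X^(odd_weight p) : {poly int}) =
    \sum_(p \in D_le N) (omega_slope p)%:P * 'X^(weight p) :> {poly int}.
Proof.
elim: N => [|N [IHe IHo]].
  rewrite !sum_D_le0 /even_weight /odd_weight /weight /omega_slope /=.
  by rewrite !big_geq //= !mul1r.
rewrite sum_omega_hatS sum_omega_slopeS -IHe -IHo !sum_D_leS.
split; congr (_ + _).
  by apply: eq_fsbigr => p _; rewrite even_weight_cons.
rewrite mulr_fsumr; apply: eq_fsbigr => p _.
by rewrite odd_weight_cons exprD.
Qed.

Theorem theorem6p3 (N : nat) :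
  \sum_(p \in D_le N) ('X^(even_weight p) : {poly int}) =
  \sum_(p \in RR_le (N%:Z - 1)) (omega_hat N p)%:P * 'X^(weight p) :> {poly int}.
Proof. by rewrite sum_RR_le_D_le; exact: (sum_even_odd_weight N).1. Qed.
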